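(* Let $n$ be a positive integer and let $T\colon M_n \rightarrow M_n$ be linear. If $T$ preserves Hadamard circulant majorization, then so does its adjoint $T^*$.
   Context: $M_n$ is the real vector space of all $n\times n$ real matrices, equipped with the inner product $\langle X,Y\rangle:=\operatorname{trace}(XY^\top)$, and $\mathbb{N}_n=\{1,\ldots,n\}$. For a linear operator $T\colon M_n\to M_n$, $T^*$ denotes its adjoint with respect to this inner product. Let $C:=[\mathbf{e}_n,\mathbf{e}_1,\ldots,\mathbf{e}_{n-1}]$ be the $n\times n$ matrix with the indicated columns, where $\mathbf{e}_i$ is the $i$th standard basis vector of $\mathbb{R}^n$; for $i\in\mathbb{N}_n$ put $C_i:=C^i$ (the $i$th power). A matrix in $M_n$ is called circulant doubly stochastic if it is a convex combination of $C_1,\ldots,C_n$. For $X=[x_{ij}],Y=[y_{ij}]\in M_n$, the Hadamard product is $X\odot Y:=[x_{ij}y_{ij}]$. We write $X\prec_{HC}Y$ ($X$ is Hadamard circulant majorized by $Y$) if there is a circulant doubly stochastic matrix $D\in M_n$ with $X=D\odot Y$. A linear operator $T\colon M_n\to M_n$ preserves Hadamard circulant majorization if $T(X)\prec_{HC}T(Y)$ whenever $X\prec_{HC}Y$. *)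

(* Defs.v *)
From HB Require Import structures.
From mathcomp Require Import all_boot all_order all_algebra.
From mathcomp Require Import reals.

Set Implicit Arguments.
Unset Strict Implicit.
Unset Printing Implicit Defensive.

Import Order.TTheory GRing.Theory Num.Theory.

Local Open Scope ring_scope.

Section HadamardCirculantMajorization.
Variables (R : realType) (n : nat).
Implicit Types (X Y D : 'M[R]_n) (T : {linear 'M[R]_n -> 'M[R]_n}).

Definition mxinner X Y : R := \tr (X *m Y^T).

Definition hadamard X Y : 'M[R]_n := map2_mx *%R X Y.

(* [ord_pred] is the cyclic predecessor: column 0 is the last standard basis
   vector and column j > 0 is the basis vector of index j - 1. *)
Definition circ_shift : 'M[R]_n := \matrix_(i, j) (i == ord_pred j)%:R.

(* With 0-based indices i : 'I_n, the powers C^1, ..., C^n are the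
   [circ_shift ^+ i.+1]. *)
Definition circulant_doubly_stochastic D : Prop :=
  exists a : 'I_n -> R,
    [/\ forall i, 0 <= a i,
        \sum_i a i = 1
      & D = \sum_i a i *: circ_shift ^+ i.+1].

Definition hc_majorized X Y : Prop :=
  exists2 D, circulant_doubly_stochastic D & X = hadamard D Y.

Definition preserves_hc_majorization T : Prop :=
  forall X Y, hc_majorized X Y -> hc_majorized (T X) (T Y).

(* The (i, j) entry of the adjoint at Y is forced to be the inner product
   <E_ij, T^* Y> = <T E_ij, Y>; [mxinner_adjoint] and [adjoint_unique] show
   that this is the adjoint. *)
Definition adjoint T Y : 'M[R]_n :=
  \matrix_(i, j) mxinner (T (delta_mx i j)) Y.

Lemma mxinnerE X Y : mxinner X Y = \sum_i \sum_j X i j * Y i j.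
Proof.
by apply: eq_bigr => i _; rewrite !mxE; apply: eq_bigr => j _; rewrite mxE.
Qed.

Lemma mxinner_deltal (i j : 'I_n) Y : mxinner (delta_mx i j) Y = Y i j.
Proof.
rewrite mxinnerE (bigD1 i) //= (bigD1 j) //= mxE !eqxx mul1r.
rewrite !big1 ?addr0 // => [k /negPf ki|k /negPf kj].
  by rewrite big1 // => l _; rewrite mxE ki mul0r.
by rewrite mxE kj andbF mul0r.
Qed.

Fact adjoint_is_linear T : linear (adjoint T).
Proof.
move=> a X Y; apply/matrixP => i j; rewrite !mxE !mxinnerE mulr_sumr -big_split.
apply: eq_bigr => k _ /=; rewrite mulr_sumr -big_split; apply: eq_bigr => l _ /=.
by rewrite !mxE mulrDr mulrCA.
Qed.

HB.instance Definition _ T :=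
  GRing.isLinear.Build R 'M[R]_n 'M[R]_n *:%R (adjoint T) (adjoint_is_linear T).

Lemma mxinner_adjoint T X Y : mxinner (T X) Y = mxinner X (adjoint T Y).
Proof.
have mxinner_suml (I : finType) (F : I -> 'M[R]_n) :
    mxinner (\sum_i F i) Y = \sum_i mxinner (F i) Y.
  by rewrite /mxinner mulmx_suml raddf_sum.
rewrite [X in T X]matrix_sum_delta raddf_sum mxinner_suml mxinnerE.
apply: eq_bigr => i _; rewrite raddf_sum mxinner_suml.
apply: eq_bigr => j _.
by rewrite /= linearZ /mxinner -scalemxAl mxtraceZ mxE.
Qed.

Lemma adjoint_unique T (S : 'M[R]_n -> 'M[R]_n) :
  (forall X Y, mxinner (T X) Y = mxinner X (S Y)) -> S =1 adjoint T.
Proof.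
move=> TS Y; apply/matrixP => i j.
by rewrite -!mxinner_deltal -TS mxinner_adjoint.
Qed.

End HadamardCirculantMajorization.

(* Main.v *)
(* The entries of a matrix split into n cyclic diagonals, and [X] is Hadamard
   circulant majorized by [Y] exactly when [X] is obtained from [Y] by scaling
   the diagonals with the coordinates of a probability vector.  Cut [T] into
   blocks accordingly.  Then [T] preserves the majorization if and only if its
   block matrix has at most one nonzero block in each row and in each column.
   This condition is invariant under transposition. *)
Require Import Defs.
From mathcomp Require Import all_boot all_order all_algebra.
From mathcomp Require Import reals.
From mathcomp Require Import lra.

Set Implicit Arguments.
Unset Strict Implicit.
Unset Printing Implicit Defensive.

Import Order.TTheory GRing.Theory Num.Theory.

Local Open Scope ring_scope.

(** Pulls a probability vector back along a partial injection. The values [a (s i)] for [i] in [L]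
    have total at most 1 by injectivity. If [L] is everything, then [s] is a bijection and the total
    is 1; otherwise one index outside [L] absorbs the missing mass. *)
Lemma probability_extension (R : realDomainType) (I : finType) (L : {set I})
    (s : I -> I) (a : I -> R) :
  {in L &, injective s} -> (forall i, 0 <= a i) -> \sum_i a i = 1 ->
  exists b : I -> R,
    [/\ forall i, 0 <= b i, \sum_i b i = 1 & {in L, forall i, b i = a (s i)}].
Proof.
move=> sI a0 a1.
have sumL : \sum_(i in L) a (s i) = \sum_(k in s @: L) a k by rewrite big_imset.
have [LT|[l0 l0L]] : L = setT \/ exists l0, l0 \notin L.
  case: (pickP [pred l | l \notin L]) => [l0 l0L|L0]; first by right; exists l0.
  by left; apply/setP => l; rewrite inE; have /negbFE := L0 l.
  exists (fun i => a (s i)); split=> //.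
  have sT : s @: L = setT.
    by apply/eqP; rewrite eqEcard subsetT card_in_imset // LT leqnn.
  rewrite -a1; transitivity (\sum_(i in L) a (s i)).
    by apply: eq_bigl => i; rewrite LT inE.
  by rewrite sumL; apply: eq_bigl => i; rewrite sT inE.
pose b i := if i \in L then a (s i)
            else if i == l0 then 1 - \sum_(i in L) a (s i) else 0.
exists b; split=> [i||i iL]; last by rewrite /b iL.
- rewrite /b; case: ifP => // _; case: ifP => // _.
  rewrite subr_ge0 sumL -a1 [leRHS](bigID (mem (s @: L))) /= lerDl.
  exact: sumr_ge0.
- rewrite (bigID (mem L)) /= [X in _ + X](bigD1 l0) //= /b (negPf l0L) eqxx.
  rewrite [X in _ + (_ + X)]big1 => [|i /andP[/negPf-> /negPf->]] //.
  by rewrite (eq_bigr (a \o s)) => [|i ->] //; rewrite addr0 addrC subrK.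
Qed.

Section CyclicDiagonals.
Variables (R : realType) (n : nat).
Implicit Types (X Y : 'M[R]_n) (T : {linear 'M[R]_n -> 'M[R]_n}).

Lemma val_iter_ordS k (i : 'I_n) : iter k (@ordS n) i = ((i + k) %% n)%N :> nat.
Proof.
elim: k => [|k IH] /=; first by rewrite addn0 modn_small.
by rewrite IH -addn1 modnDml addn1 addnS.
Qed.

(** In row [i] the powers $C^1, \ldots, C^n$ have their ones in distinct columns, hence in all [n]
    columns. This is what lets [cdiag] be an inverse function. *)
Lemma iter_ordS_inj (i : 'I_n) :
  injective (fun k : 'I_n => iter k.+1 (@ordS n) i).
Proof.
move=> k l /(congr1 (@nat_of_ord n)); rewrite !val_iter_ordS -!addSnnS => /eqP.
by rewrite eqn_modDl !modn_small // => /eqP/val_inj.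
Qed.

(* The index [k] such that the entry [(i, j)] is in the support of [C^(k+1)]. *)
Definition cdiag (p : 'I_n * 'I_n) : 'I_n := invF (@iter_ordS_inj p.1) p.2.

Lemma circ_shiftX k (i j : 'I_n) :
  (circ_shift R n ^+ k) i j = (iter k (@ordS n) i == j)%:R.
Proof.
elim: k i j => [|k IH] i j; first by rewrite expr0 mxE.
rewrite exprS mxE (bigD1 (ordS i)) //= mxE ordSK eqxx mul1r IH -iterSr.
rewrite big1 ?addr0 // => l li; rewrite mxE; case: eqP => [E|_].
  by rewrite E ord_predK eqxx in li.
by rewrite mul0r.
Qed.

Lemma circ_shift_cdiag (k i j : 'I_n) :
  (circ_shift R n ^+ k.+1) i j = (k == cdiag (i, j))%:R.
Proof.
rewrite circ_shiftX /cdiag /=; congr ((nat_of_bool _)%:R).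
rewrite -[X in _ = (X == _)](invF_f (@iter_ordS_inj i)).
by rewrite (inj_eq (can_inj (f_invF (@iter_ordS_inj i)))).
Qed.

Lemma hc_majorizedP X Y :
  hc_majorized X Y <->
  exists a : 'I_n -> R, [/\ forall k, 0 <= a k, \sum_k a k = 1
    & forall i j, X i j = a (cdiag (i, j)) * Y i j].
Proof.
have circE (a : 'I_n -> R) i j :
    (\sum_k a k *: circ_shift R n ^+ k.+1) i j = a (cdiag (i, j)).
  rewrite summxE (bigD1 (cdiag (i, j))) //= mxE circ_shift_cdiag eqxx mulr1.
  rewrite big1 ?addr0 // => k /negPf ki.
  by rewrite mxE circ_shift_cdiag ki mulr0.
split=> [[D [a [a0 a1 ->]] ->]|[a [a0 a1 XE]]].
  by exists a; split=> // i j; rewrite mxE circE.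
exists (\sum_k a k *: circ_shift R n ^+ k.+1); first by exists a.
by apply/matrixP => i j; rewrite XE mxE circE.
Qed.

Definition mxentry T (p q : 'I_n * 'I_n) : R := T (delta_mx p.1 p.2) q.1 q.2.

Lemma mxentry_adjoint T p q : mxentry (adjoint T) p q = mxentry T q p.
Proof.
rewrite /mxentry -[LHS]mxinner_deltal -mxinner_adjoint.
by rewrite /mxinner -mxtrace_tr trmx_mul trmxK [LHS]mxinner_deltal.
Qed.

Lemma mxentry_sum T X i j :
  T X i j = \sum_p X p.1 p.2 * mxentry T p (i, j).
Proof.
rewrite [X in T X]matrix_sum_delta pair_big /= raddf_sum summxE.
by apply: eq_bigr => p _; rewrite /= linearZ mxE.
Qed.

(* At most one nonzero block in each row and each column. *)
Definition block_partial_perm T : Prop :=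
  forall p p' q q', mxentry T p q != 0 -> mxentry T p' q' != 0 ->
  (cdiag p == cdiag p') = (cdiag q == cdiag q').

Lemma block_partial_perm_adjoint T :
  block_partial_perm T -> block_partial_perm (adjoint T).
Proof.
by move=> TP p p' q q'; rewrite !mxentry_adjoint => Tp Tp'; rewrite (TP q q' p p').
Qed.

Lemma block_partial_perm_preserves T :
  block_partial_perm T -> preserves_hc_majorization T.
Proof.
move=> TP X Y /hc_majorizedP[a [a0 a1 XE]]; apply/hc_majorizedP.
pose hit l := [pred w | (mxentry T w.1 w.2 != 0) && (cdiag w.2 == l)].
(* [s l] is the one input diagonal that [T] sends into the output diagonal [l]. The default [l] is
   harmless: [s] matters only on the set [L] of diagonals that are hit. *)
pose s l := if [pick w | hit l w] is Some w then cdiag w.1 else l.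
have sE p q : mxentry T p q != 0 -> s (cdiag q) = cdiag p.
  rewrite /s => Tpq; case: pickP => [w /andP[Tw /eqP wq]|/(_ (p, q))].
    by apply/eqP; rewrite (TP _ _ _ _ Tw Tpq) wq.
  by rewrite /= Tpq eqxx.
pose L := [set l | [exists w, hit l w]].
have sI : {in L &, injective s}.
  move=> l l'; rewrite !inE => /existsP[w /andP[Tw /eqP<-]].
  move=> /existsP[w' /andP[Tw' /eqP<-]]; rewrite (sE _ _ Tw) (sE _ _ Tw') => E.
  by apply/eqP; rewrite -(TP _ _ _ _ Tw Tw') E.
have [b [b0 b1 bE]] := probability_extension sI a0 a1.
exists b; split=> // i j; rewrite !mxentry_sum mulr_sumr.
apply: eq_bigr => -[k l] _ /=; rewrite XE.
have [->|Tkl] := eqVneq (mxentry T (k, l) (i, j)) 0; first by rewrite !mulr0.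
rewrite bE ?(sE _ _ Tkl) ?mulrA // inE.
by apply/existsP; exists ((k, l), (i, j)); rewrite /= Tkl eqxx.
Qed.

Lemma diagonal_majorized X Y k :
  (forall i j, X i j = (cdiag (i, j) == k)%:R * Y i j) -> hc_majorized X Y.
Proof.
move=> XE; apply/hc_majorizedP; exists (fun l => (l == k)%:R); split=> //.
by rewrite (bigD1 k) //= eqxx big1 ?addr0 // => l /negPf->.
Qed.

Lemma probability_le1 (b : 'I_n -> R) k :
  (forall l, 0 <= b l) -> \sum_l b l = 1 -> b k <= 1.
Proof.
by move=> b0 <-; rewrite (bigD1 k) //= lerDl sumr_ge0.
Qed.

Lemma delta_cdiag p k (i j : 'I_n) :
  (cdiag (i, j) == k)%:R * delta_mx p.1 p.2 i j
    = (cdiag p == k)%:R * delta_mx p.1 p.2 i j :> R.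
Proof.
case: p => p1 p2; rewrite mxE /=.
by case: (i =P p1) => [->|_]; [case: (j =P p2) => [->|_]|]; rewrite ?mulr0.
Qed.

(** If [p] and [p'] lay on different diagonals, the unit matrix at [p] would be majorized by its sum
    with any multiple [c] of the unit matrix at [p']. After applying [T], a single weight serves
    both [q] and [q'], as they share a diagonal. *)
Lemma preserves_row T p p' q q' : preserves_hc_majorization T ->
    mxentry T p q != 0 -> mxentry T p' q' != 0 ->
  cdiag q = cdiag q' -> cdiag p = cdiag p'.
Proof.
move=> TP Tp Tp' qq'; apply/eqP/negPn/negP => pp'.
have split_delta c : exists b : R, [/\ 0 <= b, b <= 1
    & {in [:: q; q'], forall r,
        mxentry T p r = b * (mxentry T p r + c * mxentry T p' r)}].
  have : hc_majorized (delta_mx p.1 p.2)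
      (delta_mx p.1 p.2 + c *: delta_mx p'.1 p'.2 : 'M[R]_n).
    apply: (@diagonal_majorized _ _ (cdiag p)) => i j.
    rewrite [in RHS]mxE [X in _ + X]mxE mulrDr mulrCA !delta_cdiag.
    by rewrite eqxx eq_sym (negPf pp') mul0r mulr0 addr0 mul1r.
  move=> /TP/hc_majorizedP[b [b0 b1 bE]].
  exists (b (cdiag q)); split; [exact: b0|exact: probability_le1|].
  move=> r rq; have <- : cdiag r = cdiag q.
    by move: rq; rewrite !inE => /orP[] /eqP->.
  by case: r {rq} => i j; rewrite /mxentry [LHS]bE linearD linearZ !mxE.
(* Both signs are needed: at the entry [q], [u = b (u + v) = d (u - v)] with
   [u] nonzero and [0 <= b, d <= 1] forces [b = d = 1]. *)
have [b [b0 b1 bE]] := split_delta 1; have [d [d0 d1 dE]] := split_delta (-1).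
have := bE q; have := bE q'; have := dE q; have := dE q'.
rewrite !inE !eqxx orbT => /(_ isT) E1 /(_ isT) E2 /(_ isT) E3 /(_ isT) E4.
have b_neq0 : b != 0 by apply: contraNneq Tp => b0'; rewrite E4 b0' mul0r.
have d_neq0 : d != 0 by apply: contraNneq Tp => d0'; rewrite E2 d0' mul0r.
(* Adding [d] times the first equation at [q] to [b] times the second eliminates [v]. Both summands
   are nonnegative, so each vanishes; then [b = 1], and the equation at [q'] gives
   [mxentry T p' q' = 0]. *)
have bd : d * (1 - b) + b * (1 - d) = 0 by apply: (mulIf Tp); nra.
have : d * (1 - b) == 0 by rewrite eq_le; apply/andP; split; nra.
rewrite mulf_eq0 (negPf d_neq0) subr_eq0 /= => /eqP b_eq1.
by case/eqP: Tp'; move: E3; rewrite -b_eq1; lra.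
Qed.

(** Majorization is not reflexive: [hc_majorized Y Y] forces weight 1 on every diagonal where [Y]
    has a nonzero entry, so there is at most one such diagonal. [T] therefore maps matrices
    supported on one diagonal to matrices of the same kind. *)
Lemma preserves_col T p p' q q' : preserves_hc_majorization T ->
    mxentry T p q != 0 -> mxentry T p' q' != 0 ->
  cdiag p = cdiag p' -> cdiag q = cdiag q'.
Proof.
move=> TP Tp Tp' pp'.
have same_diag (c c' : R) :
    c * mxentry T p q + c' * mxentry T p' q != 0 ->
    c * mxentry T p q' + c' * mxentry T p' q' != 0 -> cdiag q = cdiag q'.
  pose Y : 'M[R]_n := c *: delta_mx p.1 p.2 + c' *: delta_mx p'.1 p'.2.
  have TYE r : T Y r.1 r.2 = c * mxentry T p r + c' * mxentry T p' r.
    by rewrite /Y linearD !linearZ !mxE.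
  rewrite -!TYE => Yq Yq'.
  have : hc_majorized Y Y.
    apply: (@diagonal_majorized _ _ (cdiag p)) => i j.
    rewrite mxE [X in X + _]mxE [X in _ + X]mxE mulrDr.
    by rewrite ![_%:R * (_ * _)]mulrCA !delta_cdiag -pp' eqxx !mul1r.
  move=> /TP/hc_majorizedP[b [b0 b1 bE]].
  have b_eq1 r : T Y r.1 r.2 != 0 -> b (cdiag r) = 1.
    by case: r => i j Yr; apply: (mulIf Yr); rewrite -bE mul1r.
  apply/eqP/negPn/negP => qq'; move: b1.
  rewrite (bigD1 (cdiag q)) //= (bigD1 (cdiag q')) 1?eq_sym //=.
  rewrite !b_eq1 // => /eqP; rewrite gt_eqF // addrA ltr_wpDr ?sumr_ge0 //.
  by rewrite ltrDl ltr01.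
(* It remains to find a combination whose image is nonzero at both [q] and [q']. If neither unit
   matrix alone will do, the cross entries vanish and nothing cancels in the sum. *)
have [E|] := eqVneq (mxentry T p q') 0; last first.
  by move=> ?; apply: (same_diag 1 0); rewrite !mul0r addr0 mul1r.
have [E'|] := eqVneq (mxentry T p' q) 0; last first.
  by move=> ?; apply: (same_diag 0 1); rewrite !mul0r add0r mul1r.
by apply: (same_diag 1 1); rewrite !mul1r ?E ?E' ?addr0 ?add0r.
Qed.

Lemma preserves_block_partial_perm T :
  preserves_hc_majorization T -> block_partial_perm T.
Proof.
move=> TP p p' q q' Tp Tp'; apply/eqP/eqP.
  exact: preserves_col Tp Tp'.
exact: preserves_row Tp Tp'.
Qed.

End CyclicDiagonals.

Theorem theorem2p5 (R : realType) (n : nat) (n_gt0 : (0 < n)%N)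
    (T : {linear 'M[R]_n -> 'M[R]_n}) :
  preserves_hc_majorization T -> preserves_hc_majorization (adjoint T).
Proof.
move=> /preserves_block_partial_perm/block_partial_perm_adjoint.
exact: block_partial_perm_preserves.
Qed.
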